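(* Let $G=(V,E)$ be a complete undirected graph whose vertices are points of the Euclidean plane, with Euclidean edge weights $w_e$, let $m=|E|$, let $\alpha\in(0,2\pi]$, and let $\mathcal{F}_{xy},\mathcal{F}_{xy}^*\subseteq\mathbb{R}^m\times\mathbb{R}^{2m}$ be the polyhedra defined in the context. For any $(\overline{\mathbf{x}},\overline{\mathbf{y}})\in\mathcal{F}_{xy}^*$ there is a vector $\hat{\mathbf{y}}\in[0,1]^{2m}$ such that $(\overline{\mathbf{x}},\hat{\mathbf{y}})\in\mathcal{F}_{xy}$, and thus $w(\mathcal{F}_{xy})=w(\mathcal{F}_{xy}^* )$.
   Context: $G=(V,E)$ is a complete undirected graph with $n=|V|$ vertices and $m=|E|$ edges; the vertices are pairwise distinct points of the Euclidean plane and $w_e$ is the Euclidean distance between the endpoints of $e\in E$. For $i\in V$, $\delta(i)$ is the set of edges incident to $i$; for $S\subseteq V$, $E(S)$ is the set of edges with both endpoints in $S$. Angles: for $i\ne j$ in $V$, $\measuredangle_{0ij}\in[0,2\pi)$ is the anti-clockwise angle from the direction $(1,0)$ to the direction of the vector from $i$ to $j$. For $j,k\in V\setminus\{i\}$, $\measuredangle_{jik}=\measuredangle_{0ik}-\measuredangle_{0ij}$ if $\measuredangle_{0ik}\ge\measuredangle_{0ij}$, and $\measuredangle_{jik}=2\pi+\measuredangle_{0ik}-\measuredangle_{0ij}$ otherwise. For $i\neq j$, $L_{ij}=\{j\}\cup\{k\in V\setminus\{i,j\}:\measuredangle_{kij}\le\alpha\}$. $\mathcal{F}_{\mathcal{T}}$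 is the set of $\mathbf{x}=(x_e)_{e\in E}\in\mathbb{R}^m$ with $\sum_{e\in E}x_e=n-1$; $\sum_{e\in E(S)}x_e\le|S|-1$ for all $\emptyset\ne S\subsetneq V$; $x_e\ge0$ for all $e\in E$. $\mathcal{F}_{xy}^*$ is the set of $(\mathbf{x},\mathbf{y})$, where $\mathbf{y}=(y_{ij})$ is indexed by ordered pairs $(i,j)$ of distinct vertices (so $\mathbf{y}\in\mathbb{R}^{2m}$), such that $\mathbf{x}\in\mathcal{F}_{\mathcal{T}}$; $\sum_{j\in V\setminus\{i\}}y_{ij}=1$ for all $i\in V$; $x_e\le\sum_{k\in L_{ij}}y_{ik}$ for all $i\in V$ and $e=\{i,j\}\in\delta(i)$; and $y_{ij}\ge0$ for all $i\ne j$. $\mathcal{F}_{xy}$ is the set of $(\mathbf{x},\mathbf{y})\in\mathcal{F}_{xy}^*$ that additionally satisfy $y_{ij}\le x_e$ for all $i\in V$ and $e=\{i,j\}\in\delta(i)$. For a polyhedron $\mathcal{F}$ in $(\mathbf{x},\mathbf{y})$-space, $w(\mathcal{F})$ is the minimum of $\sum_{e\in E}w_ex_e$ over $\mathcal{F}$ (with value $+\infty$ if $\mathcal{F}=\emptyset$). *)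

(* Defs.v *)
From HB Require Import structures.
From mathcomp Require Import all_boot all_order all_algebra.
From mathcomp Require Import boolp classical_sets reals constructive_ereal trigo.
From mathcomp Require Import ring lra.

Set Implicit Arguments.
Unset Strict Implicit.
Unset Printing Implicit Defensive.

Import Order.TTheory GRing.Theory Num.Theory.
Local Open Scope ring_scope.

(* Edges of the complete graph on V, and ordered pairs of distinct vertices. *)
Notation edge V := {e : {set V} | #|e| == 2%N}.
Notation dart V := {a : V * V | a.1 != a.2}.

Section CompleteGraph.
Variable V : finType.

Definition tail (a : dart V) : V := (val a).1.
Definition head (a : dart V) : V := (val a).2.

Lemma card_dart (a : dart V) : #|[set tail a; head a]| == 2%N.
Proof. by rewrite cards2 (valP a). Qed.

(* Every edge {i, j} is the image of exactly the two darts (i, j) and (j, i), so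
   quantifying over darts a is quantifying over i and e = {i, j} in delta(i). *)
Definition edge_of (a : dart V) : edge V := exist _ [set tail a; head a] (card_dart a).

End CompleteGraph.

Section Plane.
Variable R : realType.
Implicit Types u v : R * R.

(* The library norm on R * R is the sup norm, hence this definition. *)
Definition enorm v : R := Num.sqrt (v.1 ^+ 2 + v.2 ^+ 2).
Definition edist u v : R := enorm (v.1 - u.1, v.2 - u.2).

(* Anti-clockwise angle in [0, 2 pi) from (1, 0) to v; see angle0P. *)
Definition angle0 v : R :=
  if 0 <= v.2 then acos (v.1 / enorm v) else pi *+ 2 - acos (v.1 / enorm v).

Lemma angle0P v : v != (0, 0) ->
  [/\ 0 <= angle0 v < pi *+ 2, v.1 = enorm v * cos (angle0 v)
    & v.2 = enorm v * sin (angle0 v)].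
Proof.
case: v => a b; rewrite xpair_eqE negb_and => nz.
have s_gt0 : 0 < a ^+ 2 + b ^+ 2.
  rewrite lt0r addr_ge0 ?sqr_ge0// andbT paddr_eq0 ?sqr_ge0//.
  by rewrite !sqrf_eq0 negb_and.
rewrite /angle0 /enorm /=; set r := Num.sqrt _.
have r_gt0 : 0 < r by rewrite sqrtr_gt0.
have r2 : r ^+ 2 = a ^+ 2 + b ^+ 2 by rewrite sqr_sqrtr // ltW.
have r0 : r != 0 by rewrite gt_eqF.
set c := a / r.
have ac : a = r * c by rewrite /c mulrC divfK.
have c2 : 1 - c ^+ 2 = (b / r) ^+ 2.
  by rewrite /c !expr_div_n r2; field; rewrite gt_eqF.
have cB : -1 <= c <= 1.
  rewrite -ler_norml -(@expr_le1 _ 2) // real_normK ?num_real //.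
  by rewrite -subr_ge0 c2 sqr_ge0.
have pi0 : 0 < pi :> R := pi_gt0 R.
have sE : sin (acos c) = `|b| / r.
  by rewrite sin_acos // c2 sqrtr_sqr normrM normfV (gtr0_norm r_gt0).
have cE : cos (acos c) = c by rewrite acosK // in_itv.
case: (leP 0 b) => b0.
  split; [|by rewrite cE|by rewrite sE ger0_norm // mulrC divfK].
  by rewrite acos_ge0 //= (le_lt_trans (acos_lepi cB)) // mulr2n ltrDl.
have c1 : c < 1.
  rewrite lt_neqAle; case/andP: cB => _ ->; rewrite andbT.
  apply/eqP => c1; move: c2; rewrite c1 expr1n subrr => /esym/eqP.
  by rewrite sqrf_eq0 mulf_eq0 invr_eq0 (negPf r0) orbF lt_eqF.
have cl : -1 <= c by case/andP: cB.
have h1 : 0 < acos c by rewrite acos_gt0 // cl c1.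
have h2 := acos_lepi cB.
split.
- by apply/andP; split; rewrite mulr2n; lra.
- by rewrite addrC cosD2pi cosN cE.
- by rewrite addrC sinD2pi sinN sE ltr0_norm // mulNr opprK mulrC divfK.
Qed.

End Plane.

Section Model.
Variables (R : realType) (V : finType).

Section Geometry.
Variables (p : V -> R * R) (alpha : R).

Definition angle0_of (i j : V) : R :=
  angle0 ((p j).1 - (p i).1, (p j).2 - (p i).2).

Definition angle_at (j i k : V) : R :=
  if angle0_of i j <= angle0_of i k then angle0_of i k - angle0_of i j
  else pi *+ 2 + angle0_of i k - angle0_of i j.

(* The vertices k such that a cone at i of angle alpha, starting at the
   direction of k and opening anti-clockwise, covers j. *)
Definition cover_set (i j : V) : {set V} :=
  j |: [set k | [&& k != i, k != j & angle_at k i j <= alpha]].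

Definition tree_polytope (x : edge V -> R) : Prop :=
  [/\ \sum_e x e = #|V|%:R - 1,
      forall S : {set V}, S != finset.set0 -> S \proper [set: V] ->
        \sum_(e : edge V | val e \subset S) x e <= #|S|%:R - 1
    & forall e, 0 <= x e].

Definition Fxy_star : set ((edge V -> R) * (dart V -> R)) := fun xy =>
  let: (x, y) := xy in
  [/\ tree_polytope x,
      forall i, \sum_(b : dart V | tail b == i) y b = 1,
      forall a : dart V, x (edge_of a) <=
        \sum_(b : dart V | (tail b == tail a) &&
                          (head b \in cover_set (tail a) (head a))) y b
    & forall a, 0 <= y a].

Definition Fxy : set ((edge V -> R) * (dart V -> R)) := fun xy =>
  Fxy_star xy /\ forall a : dart V, xy.2 a <= xy.1 (edge_of a).

Definition euclidean_weights (w : edge V -> R) : Prop :=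
  forall a : dart V, w (edge_of a) = edist (p (tail a)) (p (head a)).

End Geometry.

Definition cost (w x : edge V -> R) : R := \sum_e w e * x e.

(* v is the minimum of the cost over F: an attained minimum if F is nonempty,
   +oo if F is empty. *)
Definition is_minimum (w : edge V -> R)
    (F : set ((edge V -> R) * (dart V -> R))) (v : \bar R) : Prop :=
  (F = classical_sets.set0 /\ v = +oo%E) \/
  (exists z, [/\ F z, v = (cost w z.1)%:E
               & forall z', F z' -> cost w z.1 <= cost w z'.1]).

Lemma is_minimum_unique w F v v' :
  is_minimum w F v -> is_minimum w F v' -> v = v'.
Proof.
case=> [[F0 ->]|[z [Fz -> zmin]]] [[F0' ->]|[z' [Fz' -> zmin']]] //.
- by move: Fz'; rewrite F0.
- by move: Fz; rewrite F0'.
- by congr (_%:E); apply/le_anti; rewrite zmin // zmin'.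
Qed.

End Model.

(* Main.v *)
From Pilot Require Import Defs.
From mathcomp Require Import all_boot all_order all_algebra.
From mathcomp Require Import boolp classical_sets reals constructive_ereal trigo.
From mathcomp Require Import topology normedtype derive function_spaces.
From mathcomp Require Import lra.

Import Order.TTheory GRing.Theory Num.Theory.
Import numFieldNormedType.Exports.
(* From here on, [head] is the end of a dart and not that of a sequence. *)
Import Pilot.Defs.
Local Open Scope ring_scope.

Set Implicit Arguments.
Unset Strict Implicit.
Unset Printing Implicit Defensive.

(** Fix a feasible [(x, y)] of the relaxed polyhedron and call a dart [b]
overloaded when [y b] exceeds the value of [x] on its edge, deficient when it
falls short of it. The tree inequalities force [x] to have total value at least
1 around every vertex ([degree_ge1]), whereas [y] has total value exactly 1
there; so an overloaded dart at [i] coexists with a deficient dart at [i].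

Move mass from an overloaded dart [b] to the first deficient dart [c] met when
turning anti-clockwise from [b], stopping as soon as one of the two is exactly
balanced ([transfer_step]). A dart that is not deficient after the move covers
its own requirement. Any other dart [a] at the same vertex was already
deficient, hence lies no earlier than [c] in the sweep starting at [b], so a
cone of angle [alpha] starting at [b] that reaches [a] also reaches [a] when it
is started at [c] ([angle_at_shorten]): the mass moved still counts for [a].
Collinear vertices are harmless, since they are at angle 0 from each other.
Each move decreases the number of unbalanced darts, so finitely many moves
remove every overload without touching [x] ([Fxy_of_star]).

For the two minima: the cost depends on [x] alone, so a minimizer of the relaxed
polyhedron yields one of the smaller polyhedron with the same value. The relaxed
polyhedron has a minimizer when it is nonempty, since it is a closed subset of a
product of segments for the product topology, hence compact by Tychonoff's
theorem ([compact_Fxy_star]). *)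

(** * Angles around a vertex *)

Lemma angle0_of_bounds (R : realType) (V : finType) (p : V -> R * R) (i j : V) :
  injective p -> i != j -> 0 <= angle0_of p i j < pi *+ 2.
Proof.
move=> p_inj ij; rewrite /angle0_of.
have [|//] := @angle0P R ((p j).1 - (p i).1, (p j).2 - (p i).2).
apply: contraNneq ij => -[d1 d2]; apply/eqP/p_inj.
by rewrite [LHS]surjective_pairing [RHS]surjective_pairing; congr pair; lra.
Qed.

Lemma angle_atxx (R : realType) (V : finType) (p : V -> R * R) (i j : V) :
  angle_at p j i j = 0.
Proof. by rewrite /angle_at lexx subrr. Qed.

(** Angles starting at the direction of [j] behave like a linear order on the
directions around [i]: going first from [j] to [k] and then on to [l] wraps
around only if [l] precedes [k], which the hypothesis excludes. *)
Lemma angle_at_shorten (R : realType) (V : finType) (p : V -> R * R)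
    (i j k l : V) :
  injective p -> i != j -> i != k -> i != l ->
  angle_at p j i k <= angle_at p j i l -> angle_at p k i l <= angle_at p j i l.
Proof.
move=> p_inj /(angle0_of_bounds p_inj) + /(angle0_of_bounds p_inj) +
  /(angle0_of_bounds p_inj); rewrite /angle_at.
move: (angle0_of p i j) (angle0_of p i k) (angle0_of p i l) => u v t.
by move=> /andP[? ?] /andP[? ?] /andP[? ?];
  case: (leP u v); case: (leP u t); case: (leP v t); lra.
Qed.

(** The vertex [j], added separately to its cover set, is at angle 0 from
itself, so that the angular condition alone describes the set. *)
Lemma in_cover_set (R : realType) (V : finType) (p : V -> R * R) (alpha : R)
    (i j k : V) :
  0 <= alpha -> i != k ->
  (k \in cover_set p alpha i j) = (angle_at p k i j <= alpha).
Proof.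
move=> alpha0 ik; rewrite !inE (eq_sym k i) ik /=.
by have [->|//] := eqVneq k j; rewrite angle_atxx alpha0.
Qed.

(** * Removing overloads *)

(** The subset inequality of the complement of [tail b] leaves at most [#|V| - 2]
of the total value [#|V| - 1] to the edges avoiding [tail b]. The dart [b] ensures
that this complement is nonempty. *)
Lemma degree_ge1 (R : realType) (V : finType) (x : edge V -> R) (b : dart V) :
  tree_polytope x -> 1 <= \sum_(d : dart V | tail d == tail b) x (edge_of d).
Proof.
move=> [sumx subx x_ge0]; set i := tail b.
have ib : i != head b by exact: (valP b).
have := subx ([set: V] :\ i).
have -> : [set: V] :\ i != finset.set0.
  by apply/set0Pn; exists (head b); rewrite !inE andbT eq_sym.
rewrite properD1 ?inE // => /(_ isT isT).
have := cardsD1 i [set: V]; rewrite inE cardsT => cardV; rewrite cardV natrD in sumx.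
have inS (e : edge V) : (val e \subset [set: V] :\ i) = (i \notin val e).
  by rewrite finset.subsetD1 finset.subsetT.
rewrite (eq_bigl _ _ inS); move: sumx; rewrite (bigID (fun e : edge V => i \in val e)) /=.
suff : \sum_(e : edge V | i \in val e) x e <=
       \sum_(d : dart V | tail d == i) x (edge_of d) by lra.
rewrite (partition_big (@edge_of V) (fun e : edge V => i \in val e)) /=; last first.
  by move=> d /eqP <-; rewrite !inE eqxx.
apply: ler_sum => e; rewrite -[sval e]/(val e) => ie.
have /cards2P[u [v [uv Ee]]] := valP e.
have [j ij Eij] : exists2 j, i != j & val e = [set i; j].
  move: ie; rewrite Ee !inE => /orP[] /eqP ->; first by exists v.
  by exists u; [rewrite eq_sym | rewrite finset.setUC].
have Ed : edge_of (exist _ (i, j) ij : dart V) = e by apply: val_inj; rewrite Eij.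
(* One dart out of [i] over [e] is enough: the other terms are nonnegative. *)
rewrite (bigD1 (exist _ (i, j) ij : dart V)) /= ?Ed ?eqxx // lerDl.
by apply: sumr_ge0.
Qed.

(** The termination measure of the transfers. *)
Definition imbalance {R : realType} {V : finType} (x : edge V -> R)
  (y : dart V -> R) : nat := #|[pred d : dart V | y d != x (edge_of d)]|.

(** Writing a transfer of [t] from [b] to [c] with indicators makes its effect on
every partial sum depend only on whether [b] and [c] are counted there. *)
Lemma sum_transfer (R : realType) (D : finType) (y : D -> R) (b c : D) (t : R)
    (P : pred D) :
  \sum_(d | P d) (y d + t * ((d == c)%:R - (d == b)%:R)) =
  \sum_(d | P d) y d + t * ((P c)%:R - (P b)%:R).
Proof.
have sumP a : \sum_(d | P d) (d == a)%:R = (P a)%:R :> R.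
  rewrite big_mkcond (bigD1 a) //= eqxx big1 ?addr0 => [|d /negPf ->].
    by case: (P a).
  by case: ifP.
by rewrite big_split -mulr_sumr sumrB !sumP.
Qed.

(** The target of the transfer is the deficient dart closest to [b] in the
anti-clockwise direction. A dart left deficient is then at least as far from [b]
as the target, and is covered by the target whenever it is covered by [b]. *)
Lemma transfer_step (R : realType) (V : finType) (p : V -> R * R) (alpha : R)
    (x : edge V -> R) (y : dart V -> R) (b : dart V) :
  injective p -> 0 <= alpha -> Fxy_star p alpha (x, y) ->
  x (edge_of b) < y b ->
  exists y', Fxy_star p alpha (x, y') /\ (imbalance x y' < imbalance x y)%N.
Proof.
move=> p_inj alpha0 [treex sumy covy y_ge0] excess_b.
have x_ge0 : forall e, 0 <= x e by case: treex.
pose turn (d : dart V) := angle_at p (head b) (tail b) (head d).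
pose deficit (d : dart V) := (tail d == tail b) && (y d < x (edge_of d)).
have [c0 def_c0] : exists d, deficit d.
  apply/existsP; apply: contraT => /existsPn nodef.
  have := degree_ge1 b treex; rewrite -(sumy (tail b)) leNgt => /negP[].
  rewrite (bigD1 b) //= [ltRHS](bigD1 b) //= ltr_leD // ler_sum // => d /andP[db _].
  by have := nodef d; rewrite /deficit db -leNgt.
have [c /andP[/eqP tc def_c] c_min] := arg_minP turn def_c0.
(* The largest amount that makes neither [b] deficient nor [c] overloaded. *)
pose t := Num.min (y b - x (edge_of b)) (x (edge_of c) - y c).
have t_gt0 : 0 < t by rewrite lt_min; apply/andP; split; lra.
have [tb tcle] : t <= y b - x (edge_of b) /\ t <= x (edge_of c) - y c.
  by split; rewrite ge_min lexx ?orbT.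
have cb : c != b by apply: contraTneq def_c => ->; rewrite -leNgt ltW.
pose y' d := y d + t * ((d == c)%:R - (d == b)%:R).
have y'b : y' b = y b - t by rewrite /y' eqxx eq_sym (negPf cb) sub0r mulrN1.
have y'c : y' c = y c + t by rewrite /y' eqxx (negPf cb) subr0 mulr1.
have y'E d : d != b -> d != c -> y' d = y d.
  by move=> /negPf db /negPf dc; rewrite /y' db dc subrr mulr0 addr0.
have y'ge d : d != b -> y d <= y' d.
  by move=> db; have [->|dc] := eqVneq d c; [rewrite y'c; lra | rewrite y'E].
have y'_ge0 d : 0 <= y' d.
  have [->|db] := eqVneq d b; last exact: le_trans (y_ge0 d) (y'ge d db).
  by rewrite y'b; have := x_ge0 (edge_of b); lra.
exists y'; split; first split => //.
- by move=> i; rewrite sum_transfer tc subrr mulr0 addr0 sumy.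
- move=> a; have [small|large] := leP (x (edge_of a)) (y' a).
    (* A dart that is not deficient covers itself. *)
    apply: le_trans small _.
    rewrite (bigD1 a) /= ?lerDl ?sumr_ge0 //.
    by rewrite eqxx !inE eqxx.
  rewrite sum_transfer /= tc; apply: le_trans (covy a) _.
  rewrite lerDl; apply: mulr_ge0; first exact: ltW.
  (* It remains to see that [c] covers [a] if [b] does. *)
  rewrite subr_ge0 ler_nat; have [ta|//] := eqVneq (tail b) (tail a).
  have ab : a != b by apply: contraTneq large => ->; rewrite y'b -leNgt; lra.
  have ib : tail b != head b := valP b.
  have ic : tail b != head c by rewrite -tc; exact: (valP c).
  have ia : tail b != head a by rewrite ta; exact: (valP a).
  rewrite -ta !in_cover_set //=.
  have [ba|//] := boolP (angle_at p (head b) (tail b) (head a) <= alpha).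
  rewrite (le_trans (angle_at_shorten p_inj ib ic ia _) ba) //.
  apply: c_min; rewrite /deficit ta eqxx /=.
  exact: le_lt_trans (y'ge a ab) large.
- apply: proper_card; apply/properP; split.
    apply/fintype.subsetP => d; rewrite !inE; apply: contraNneq => yd.
    rewrite y'E ?yd //; first by apply: contraTneq excess_b => <-; rewrite yd ltxx.
    by apply: contraTneq def_c => <-; rewrite yd ltxx.
  have [tE|tE] : t = y b - x (edge_of b) \/ t = x (edge_of c) - y c.
    by rewrite /t; case: leP; [left | right].
  + by exists b; rewrite !inE; [rewrite gt_eqF | rewrite y'b tE subKr eqxx].
  + by exists c; rewrite !inE; [rewrite lt_eqF | rewrite y'c tE addrC subrK eqxx].
Qed.

Lemma Fxy_of_star (R : realType) (V : finType) (p : V -> R * R) (alpha : R)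
    (x : edge V -> R) (y : dart V -> R) :
  injective p -> 0 <= alpha -> Fxy_star p alpha (x, y) ->
  exists y', Fxy p alpha (x, y').
Proof.
move=> p_inj alpha0; have [n] := ubnP (imbalance x y).
elim: n y => // n IHn y; rewrite ltnS => le_n star.
have [/forallP fits|] := boolP [forall a, y a <= x (edge_of a)].
  by exists y; split.
rewrite negb_forall => /existsP[b]; rewrite -ltNge => excess_b.
have [y' [star' lt_y]] := transfer_step p_inj alpha0 star excess_b.
by apply: IHn star'; exact: leq_trans lt_y le_n.
Qed.

Lemma Fxy_star_y_le1 (R : realType) (V : finType) (p : V -> R * R) (alpha : R)
    (x : edge V -> R) (y : dart V -> R) (a : dart V) :
  Fxy_star p alpha (x, y) -> y a <= 1.
Proof.
move=> [_ sumy _ y_ge0]; rewrite -(sumy (tail a)) (bigD1 a) //= lerDl.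
by apply: sumr_ge0.
Qed.

(** * Compactness and attainment of the minimum *)

Lemma closed_le_fun (T : topologicalType) (R : realType) (f g : T -> R) :
  continuous f -> continuous g -> closed [set z | f z <= g z]%classic.
Proof.
move=> cf cg.
have -> : [set z | f z <= g z]%classic = ((fun z => g z - f z) @^-1` [set r | 0 <= r])%classic.
  by apply/predeqP => z /=; rewrite subr_ge0.
apply: closed_comp; last exact: closed_ge.
by move=> z _; apply: continuousB; [apply: cg | apply: cf].
Qed.

Lemma closed_eq_fun (T : topologicalType) (R : realType) (f : T -> R) (r : R) :
  continuous f -> closed [set z | f z = r]%classic.
Proof.
move=> cf; apply: (@closed_comp _ _ f [set s | s = r]%classic); last exact: closed_eq.
by move=> z _; exact: cf.
Qed.

Lemma closed_forall (T : topologicalType) (I : Type) (P : I -> T -> Prop) :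
  (forall i, closed [set z | P i z]%classic) ->
  closed [set z | forall i, P i z]%classic.
Proof.
move=> cP.
have -> : [set z | forall i, P i z]%classic = (\bigcap_i [set z | P i z])%classic.
  by apply/predeqP => z; split => [h i _|h i]; exact: h.
by apply: closed_bigI => i _; exact: cP.
Qed.

Lemma continuous_sum (T : topologicalType) (R : realType) (I : finType)
    (P : pred I) (F : I -> T -> R) :
  (forall i, continuous (F i)) -> continuous (fun z => \sum_(i | P i) F i z).
Proof.
move=> cF; apply: continuous_big => [|i _]; last exact: cF.
exact: add_continuous.
Qed.

Section Attainment.
Context {R : realType} {V : finType}.

(** Points carry the product topology, for which each coordinate is continuous
and Tychonoff's theorem holds. *)
Local Notation point :=
  ({ptws edge V -> R} * {ptws dart V -> R})%type.

Lemma x_continuous (e : edge V) : continuous (fun z : point => z.1 e : R).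
Proof.
move=> z; apply: (@continuous_comp _ _ _ fst (fun f : {ptws edge V -> R} => f e)).
  exact: cvg_fst.
exact: (@proj_continuous _ (fun=> R) e).
Qed.

Lemma y_continuous (d : dart V) : continuous (fun z : point => z.2 d : R).
Proof.
move=> z; apply: (@continuous_comp _ _ _ snd (fun f : {ptws dart V -> R} => f d)).
  exact: cvg_snd.
exact: (@proj_continuous _ (fun=> R) d).
Qed.

Lemma cost_continuous (w : edge V -> R) :
  continuous (fun z : point => cost w z.1).
Proof.
apply: continuous_sum => e z.
by apply: continuousM; [exact: cst_continuous | exact: x_continuous].
Qed.

Lemma closed_Fxy_star (p : V -> R * R) (alpha : R) :
  closed (Fxy_star p alpha : set point).
Proof.
have -> : (Fxy_star p alpha : set point) =
  ([set z | \sum_e z.1 e = #|V|%:R - 1] `&`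
   [set z | forall S : {set V}, S != finset.set0 -> S \proper finset.setT ->
              \sum_(e : edge V | val e \subset S) z.1 e <= #|S|%:R - 1] `&`
   [set z | forall e, 0 <= z.1 e] `&`
   [set z | forall i, \sum_(b : dart V | tail b == i) z.2 b = 1] `&`
   [set z | forall a : dart V, z.1 (edge_of a) <=
        \sum_(b : dart V | (tail b == tail a) &&
                     (head b \in cover_set p alpha (tail a) (head a))) z.2 b] `&`
   [set z | forall a, 0 <= z.2 a])%classic.
  apply/predeqP => -[x y]; split=> [[[? ? ?] ? ? ?]|[[[[[? ?] ?] ?] ?] ?]].
    by do !split.
  by split; first split.
have cx := x_continuous; have cy := y_continuous.
repeat apply: closedI.
- exact/closed_eq_fun/continuous_sum.
- do 3!apply: closed_forall => ?.
  by apply: closed_le_fun; [exact: continuous_sum | exact: cst_continuous].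
- by apply: closed_forall => e; apply: closed_le_fun; [exact: cst_continuous|].
- by apply: closed_forall => i; exact/closed_eq_fun/continuous_sum.
- by apply: closed_forall => a; apply: closed_le_fun => //; exact: continuous_sum.
- by apply: closed_forall => a; apply: closed_le_fun; [exact: cst_continuous|].
Qed.

(** Nonnegativity together with the total value of [x] and the total value 1 of
[y] around each vertex bounds every coordinate. *)
Lemma compact_Fxy_star (p : V -> R * R) (alpha : R) :
  compact (Fxy_star p alpha : set point).
Proof.
(* The bound dominates both [#|V| - 1] and [1]. *)
pose box (I : eqType) : set {ptws I -> R} :=
  [set f | forall i, `[0, #|V|%:R + 1]%classic (f i)]%classic.
have cbox I : compact (box I).
  exact: (@tychonoff I (fun=> R) (fun=> `[0, #|V|%:R + 1]%classic)
            (fun=> @segment_compact R _ _)).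
apply: (@subclosed_compact point (Fxy_star p alpha)
          (box (edge V) `*` box (dart V))%classic).
- exact: closed_Fxy_star.
- exact (compact_setX (cbox (edge V)) (cbox (dart V))).
move=> -[x y] star; have y1 a := Fxy_star_y_le1 a star.
case: star => [[sumx _ x_ge0] _ _ y_ge0].
have n0 : 0 <= #|V|%:R :> R by [].
split=> [e|a] /=; rewrite in_itv /= ?x_ge0 ?y_ge0 /=.
  have : x e <= \sum_e x e by rewrite (bigD1 e) //= lerDl sumr_ge0.
  by rewrite sumx; lra.
by have := y1 a; lra.
Qed.

Lemma Fxy_star_has_min (p : V -> R * R) (alpha : R) (w : edge V -> R) :
  (Fxy_star p alpha !=set0)%classic ->
  exists2 z, Fxy_star p alpha z &
    forall z', Fxy_star p alpha z' -> cost w z.1 <= cost w z'.1.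
Proof.
move=> F0; have cF := @compact_Fxy_star p alpha.
have [|z /set_mem Fz zmin] := compact_EVT_min F0 cF (f := fun z : point => cost w z.1).
  exact/continuous_subspaceT/cost_continuous.
by exists z => // z' Fz'; apply: zmin; exact/mem_set.
Qed.

End Attainment.

Unset Implicit Arguments.

Theorem proposition3 (R : realType) (V : finType) (p : V -> R * R)
    (p_inj : injective p) (w : edge V -> R) (hw : euclidean_weights p w)
    (alpha : R) (halpha : 0 < alpha <= pi *+ 2) :
  (forall (xbar : edge V -> R) (ybar : dart V -> R),
     Fxy_star p alpha (xbar, ybar) ->
     exists yhat : dart V -> R,
       (forall a, 0 <= yhat a <= 1) /\ Fxy p alpha (xbar, yhat))
  /\ (exists v : \bar R,
        is_minimum w (Fxy p alpha) v /\ is_minimum w (Fxy_star p alpha) v).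
Proof.
have alpha0 : 0 <= alpha by case/andP: halpha => /ltW.
split=> [x y star|].
  have [y' Fxy'] := Fxy_of_star p_inj alpha0 star.
  exists y'; split=> // a; have star' := Fxy'.1.
  rewrite (Fxy_star_y_le1 a star') andbT.
  by case: star'.
have [F0|/set0P F0] := eqVneq (Fxy_star p alpha) classical_sets.set0.
  exists +oo%E; split; left; split=> //.
  by apply/predeqP => z; split=> [[]|//]; rewrite F0.
have [[x y] Fz zmin] := Fxy_star_has_min w F0.
have [y' Fxy'] := Fxy_of_star p_inj alpha0 Fz.
exists (cost w x)%:E; split; right; last by exists (x, y).
by exists (x, y'); split=> // z' [/zmin].
Qed.
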